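(* Let $F$ be a Finsler structure on a smooth manifold $M$, and let $d(F)$ be the weak metric induced by $F$ on $M$. Let $(x_i)$ be a sequence in $M$ and let $x\in M$. Then the following three conditions are equivalent: (i) $d(F)(x_i,x)\to 0$; (ii) $d(F)(x,x_i)\to 0$; (iii) $(x_i)$ converges to $x$ with respect to the (manifold) topology of $M$. In particular, $d(F)$ satisfies Busemann's axiom.
   Context: A Finsler structure on a smooth manifold $M$ is a continuous function $F\colon TM\to[0,\infty)$ such that for every $x\in M$ the restriction $F(x,\cdot)$ to $T_xM$ is a weak norm, i.e. $F(x,v_1+v_2)\le F(x,v_1)+F(x,v_2)$ for all $v_1,v_2\in T_xM$; $F(x,\lambda v)=\lambda F(x,v)$ for all $\lambda\ge 0$ and $v\in T_xM$; and $F(x,v)=0$ if and only if $v=0$. (No symmetry $F(x,-v)=F(x,v)$ and no further regularity is assumed.) The length of a piecewise $C^1$-path $\beta\colon[a,b]\to M$ is $l_F(\beta)=\int_a^bF(\beta(s),\dot\beta(s))\,ds$. The induced weak metric $d(F)(x,y)$ is the infimum of $l_F(\beta)$ over all piecewise $C^1$-paths $\beta$ from $x$ to $y$ (and $\infty$ if there is none). A weak metric on a set $X$ is a function $\eta\colon X\times X\to[0,\infty]$ with $\eta(x,x)=0$ and $\eta(x,z)\le\eta(x,y)+\eta(y,z)$ for all $x,y,z\in X$. It satisfies Busemann's axiom if for every sequence $(x_n)$ in $X$ and every $x\in X$, $\eta(x_n,x)\to0$ if and only if $\eta(x,x_n)\to0$. *)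

(* Defs.v *)
From HB Require Import structures.
From mathcomp Require Import all_boot all_order all_algebra.
From mathcomp Require Import all_classical all_reals all_analysis.

Set Implicit Arguments.
Unset Strict Implicit.
Unset Printing Implicit Defensive.
Import Order.TTheory GRing.Theory Num.Theory.
Import numFieldNormedType.Exports.

Local Open Scope classical_set_scope.
Local Open Scope ring_scope.

(* [f] is C^k on [U], which is always an open set below: differentiable, with
   every directional derivative x |-> 'D_v f x of class C^(k-1). *)
Fixpoint Ck {R : realType} {V W : normedModType R} (k : nat) (U : set V)
    (f : V -> W) : Prop :=
  if k is k'.+1 then
    (forall x, U x -> differentiable f x) /\
    (forall v : V, Ck k' U (fun x => 'D_v f x))
  else forall x, U x -> {for x, continuous f}.

Definition smooth {R : realType} {V W : normedModType R} (U : set V)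
  (f : V -> W) : Prop := forall k : nat, Ck k U f.

(* A homeomorphism between an open subset of [M] and an open subset of R^n.
   Both maps are total functions; their values elsewhere are irrelevant. *)
Record chart (R : realType) (n : nat) (M : topologicalType) := Chart {
  chart_map :> M -> 'rV[R]_n ;
  chart_inv : 'rV[R]_n -> M ;
  chart_dom : set M ;
  chart_dom_open : open chart_dom ;
  chart_img_open : open (chart_map @` chart_dom) ;
  chart_mapK : forall x, chart_dom x -> chart_inv (chart_map x) = x ;
  chart_map_continuous :
    forall x, chart_dom x -> {for x, continuous chart_map} ;
  chart_inv_continuous :
    forall p, (chart_map @` chart_dom) p -> {for p, continuous chart_inv}
}.

Definition chart_img (R : realType) (n : nat) (M : topologicalType)
  (c : chart R n M) : set 'rV[R]_n := c @` chart_dom c.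

Definition transition (R : realType) (n : nat) (M : topologicalType)
  (c c' : chart R n M) : 'rV[R]_n -> 'rV[R]_n := c' \o chart_inv c.

Record smooth_manifold (R : realType) (n : nat) (M : topologicalType) :=
  SmoothManifold {
  manifold_hausdorff : hausdorff_space M ;
  manifold_second_countable : @second_countable M ;
  atlas_index : Type ;
  atlas :> atlas_index -> chart R n M ;
  atlas_cover : forall x : M, exists i, chart_dom (atlas i) x ;
  atlas_smooth : forall i j,
    smooth (atlas i @` (chart_dom (atlas i) `&` chart_dom (atlas j)))
           (transition (atlas i) (atlas j))
}.

Definition chart_at (R : realType) (n : nat) (M : topologicalType)
  (A : smooth_manifold R n M) (x : M) : chart R n M :=
  A (projT1 (cid (atlas_cover A x))).

(* T_xM is identified with R^n through the coordinates of [chart_at A x]; the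
   vector with coordinates u in another chart c around x is represented by
   D(chart_at A x \o c^-1)(c x) u. *)
Definition tangent_space (R : realType) (n : nat) (M : topologicalType)
  (A : smooth_manifold R n M) (x : M) : Type := 'rV[R]_n.

Record tangent_bundle (R : realType) (n : nat) (M : topologicalType)
    (A : smooth_manifold R n M) := TangentVector {
  foot : M ;
  vec : tangent_space A foot
}.
Arguments TangentVector {R n M A} foot vec.

(* The inverse of the bundle chart of TM induced by the chart [A i]: it sends
   (p, u) to the vector at the point of coordinates p whose coordinates in the
   chart [A i] are u. It is meaningful for p in [chart_img (A i)]. *)
Definition bundle_chart_inv (R : realType) (n : nat) (M : topologicalType)
    (A : smooth_manifold R n M) (i : atlas_index A)
    (pu : 'rV[R]_n * 'rV[R]_n) : tangent_bundle A :=
  let x := chart_inv (A i) pu.1 in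
  TangentVector x ('d (transition (A i) (chart_at A x)) (pu.1) pu.2).

(* The usual topology of TM: the one for which the bundle charts are
   homeomorphisms between open sets. *)
Definition bundle_open (R : realType) (n : nat) (M : topologicalType)
    (A : smooth_manifold R n M) : set (set (tangent_bundle A)) :=
  [set V | forall i : atlas_index A,
    open (chart_img (A i) `*` setT `&` bundle_chart_inv i @^-1` V)].

Lemma bundle_openT (R : realType) (n : nat) (M : topologicalType)
  (A : smooth_manifold R n M) : @bundle_open R n M A setT.
Proof.
move=> i; rewrite preimage_setT setIT.
have -> : chart_img (A i) `*` setT =
    (@fst 'rV[R]_n 'rV[R]_n) @^-1` chart_img (A i).
  by apply/seteqP; split=> [p []|p pA] //=; split.
apply: open_comp; last exact: chart_img_open.
by move=> p _; exact: cvg_fst.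
Qed.

Lemma bundle_openI (R : realType) (n : nat) (M : topologicalType)
  (A : smooth_manifold R n M) : setI_closed (@bundle_open R n M A).
Proof. by move=> U V oU oV i; rewrite preimage_setI setIIr; exact: openI. Qed.

Lemma bundle_open_bigU (R : realType) (n : nat) (M : topologicalType)
  (A : smooth_manifold R n M) (I : Type) (f : I -> set (tangent_bundle A)) :
  (forall j, bundle_open (f j)) -> bundle_open (\bigcup_j f j).
Proof.
move=> of_ i; rewrite preimage_bigcup setI_bigcupr.
by apply: bigcup_open => j _; exact: of_.
Qed.

HB.instance Definition _ (R : realType) (n : nat) (M : topologicalType)
  (A : smooth_manifold R n M) := gen_eqMixin (tangent_bundle A).
HB.instance Definition _ (R : realType) (n : nat) (M : topologicalType)
  (A : smooth_manifold R n M) := gen_choiceMixin (tangent_bundle A).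
HB.instance Definition _ (R : realType) (n : nat) (M : topologicalType)
  (A : smooth_manifold R n M) :=
  isOpenTopological.Build (tangent_bundle A)
    (@bundle_openT R n M A) (@bundle_openI R n M A) (@bundle_open_bigU R n M A).

Record finsler_structure (R : realType) (n : nat) (M : topologicalType)
    (A : smooth_manifold R n M) (F : tangent_bundle A -> R) : Prop := {
  finsler_continuous : continuous F ;
  finsler_ge0 : forall v, 0 <= F v ;
  finsler_triangle : forall (x : M) (v1 v2 : tangent_space A x),
    F (TangentVector x (v1 + v2)) <= F (TangentVector x v1) + F (TangentVector x v2) ;
  finsler_homogeneous : forall (x : M) (l : R) (v : tangent_space A x),
    0 <= l -> F (TangentVector x (l *: v)) = l * F (TangentVector x v) ;
  finsler_eq0 : forall (x : M) (v : tangent_space A x),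
    F (TangentVector x v) = 0 <-> v = 0
}.

(* C^1 on the closed interval [a, b] with a < b: in every chart the difference
   quotients within [a, b] converge (one-sidedly at a and b) to a continuous
   function g. *)
Definition C1_path (R : realType) (n : nat) (M : topologicalType)
    (A : smooth_manifold R n M) (a b : R) (beta : R -> M) : Prop :=
  {within `[a, b], continuous beta} /\
  forall i : atlas_index A, exists g : R -> 'rV[R]_n,
    let D := [set` `[a, b]] `&` beta @^-1` chart_dom (A i) in
    {within D, continuous g} /\
    forall s, D s ->
      (t - s)^-1 *: (A i (beta t) - A i (beta s)) @[t --> within D s^'] --> g s.

(* The points a :: s form a partition of [a, b]; the restriction of [beta] to
   each of its closed pieces is C^1. Only the values of [beta] on [a, b]
   matter. *)
Definition piecewise_C1_path (R : realType) (n : nat) (M : topologicalType)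
    (A : smooth_manifold R n M) (a b : R) (beta : R -> M) : Prop :=
  exists s : seq R, itv_partition a b s /\
    forall k, (k < size s)%N ->
      C1_path A (nth b (a :: s) k) (nth b (a :: s) k.+1) beta.

(* Its value is irrelevant at the finitely many points where [beta] is not
   differentiable. *)
Definition velocity (R : realType) (n : nat) (M : topologicalType)
    (A : smooth_manifold R n M) (beta : R -> M) (s : R) :
    tangent_space A (beta s) :=
  derive1 (chart_at A (beta s) \o beta) s.

Definition path_length (R : realType) (n : nat) (M : topologicalType)
    (A : smooth_manifold R n M) (F : tangent_bundle A -> R) (a b : R)
    (beta : R -> M) : \bar R :=
  (\int[@lebesgue_measure R]_(s in `[a, b])
    (F (TangentVector (beta s) (velocity A beta s)))%:E)%E.

Definition finsler_dist (R : realType) (n : nat) (M : topologicalType)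
    (A : smooth_manifold R n M) (F : tangent_bundle A -> R) (x y : M) : \bar R :=
  ereal_inf [set l | exists a b beta,
    [/\ piecewise_C1_path A a b beta, beta a = x, beta b = y &
        l = path_length F a b beta]].

Definition busemann_axiom (R : realType) (X : Type) (eta : X -> X -> \bar R) :
    Prop :=
  forall (x_ : nat -> X) (x : X),
    (eta (x_ k) x @[k --> \oo] --> 0%E) <-> (eta x (x_ k) @[k --> \oo] --> 0%E).

(* Main.v *)
Require Import Defs.
From mathcomp Require Import all_boot all_order all_algebra.
From mathcomp Require Import all_classical all_reals all_analysis.
From mathcomp Require Import measurable_realfun.
From mathcomp Require Import ring.

Set Implicit Arguments.
Unset Strict Implicit.
Unset Printing Implicit Defensive.
Import Order.TTheory GRing.Theory Num.Theory.
Import numFieldNormedType.Exports.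

Local Open Scope classical_set_scope.
Local Open Scope ring_scope.

(** The idea is to compare [F] with the coordinate norm near a point. In a chart
    around [x], [F] becomes a continuous function [G] of a point [p] and a vector
    [u] of R^n; it is positively homogeneous in [u] and vanishes only for [u = 0],
    the derivatives of the transition maps being injective. By compactness of
    (closed ball) x (unit sphere) there are constants [m, C > 0] such that
    [m * `|u| <= G (p, u) <= C * `|u|] for all [p] in a closed ball around the
    coordinates of [x] ([norm_comparison], [finsler_local_comparison]).

    If [y] and [z] are in the coordinate ball, the segment from [y] to [z] in the
    chart is a C^1 path, of length at most [C * `|z - y|] ([finsler_dist_le_line]);
    hence convergence in the manifold topology implies convergence of the
    distances, in both directions.

    Conversely, a piecewise C^1 path with one end at [x] and the other outside the
    coordinate ball of radius [r] contains a subpath that stays in the closed ball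
    and joins [x] to its boundary: it stops at the first exit time, or starts at
    the last entrance time ([first_exit], [last_entrance]). The closed coordinate
    ball is closed in the manifold because it is compact and the manifold is
    Hausdorff. By the fundamental theorem of calculus, applied to one coordinate at
    a time on each C^1 piece, the length is at least [m * r]
    ([subpath_length_ge]). So a point at distance less than [m * r] from [x], or to
    [x], lies in the coordinate ball ([finsler_dist_lt_ball]). Since these balls form
    a neighbourhood basis of [x], each of the two convergences of distances implies
    convergence in the manifold. *)

(** * Norms, derivatives and limits *)

Lemma norm_ball_compact (R : realType) (n : nat) (p0 : 'rV[R]_n) (r : R) :
  compact [set p | `|p - p0| <= r].
Proof.
apply: bounded_closed_compact.
  exists (`|p0| + r); split; first exact: num_real.
  move=> B BB p /= pr; apply/ltW/le_lt_trans/BB.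
  rewrite -[p](subrK p0); apply: le_trans (ler_normD _ _) _.
  by rewrite addrC lerD2l.
have -> : [set p | `|p - p0| <= r] = (fun p => `|p - p0|) @^-1` [set t | t <= r] by [].
apply: closed_comp; last exact: closed_le.
move=> p _; exact: (cvg_norm (cvgB (@cvg_id _ _) (cvg_cst p0))).
Qed.

(** A positively homogeneous function of [u] that is positive for [u != 0] and
    continuous in [(p, u)] is equivalent to the norm, uniformly for [p] in a
    compact set. *)
Lemma norm_comparison (R : realType) (n : nat) (K : set 'rV[R]_n)
    (G : 'rV[R]_n * 'rV[R]_n -> R) :
  compact K ->
  (forall p u, K p -> {for (p, u), continuous G}) ->
  (forall p u, K p -> u != 0 -> 0 < G (p, u)) ->
  (forall p u l, K p -> 0 <= l -> G (p, l *: u) = l * G (p, u)) ->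
  exists m C : R, [/\ 0 < m, 0 < C &
    forall p u, K p -> m * `|u| <= G (p, u) <= C * `|u|].
Proof.
move=> cK cG pG hG.
pose S := [set u : 'rV[R]_n | `|u| = 1].
have cS : compact S.
  apply: bounded_closed_compact.
    exists 1; split => // x x1 u; rewrite /S /= => ->; exact: ltW.
  apply: (@closed_comp _ _ (fun u : 'rV[R]_n => `|u|) [set 1]).
    by move=> u _; exact: norm_continuous.
  exact: closed_eq.
have cKS : compact (K `*` S) by exact: compact_setX.
have S0 u : S u -> u != 0.
  rewrite /S /= => u1; apply/eqP => u0; move: u1.
  by rewrite u0 normr0 => /esym/eqP; rewrite oner_eq0.
have bnd (h : 'rV[R]_n * 'rV[R]_n -> R) :
    (forall p u, K p -> S u -> {for (p, u), continuous h}) ->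
    exists C, 0 < C /\ forall p u, K p -> S u -> h (p, u) <= C.
  move=> ch; have : compact (h @` (K `*` S)).
    apply: continuous_compact => //.
    apply: continuous_in_subspaceT => -[p u]; rewrite inE => -[/= Kp Su].
    exact: ch.
  move=> /compact_bounded[C [_ HC]].
  exists (`|C| + 1); split; first by rewrite ltr_wpDl.
  move=> p u Kp Su; rewrite (le_trans (ler_norm _))//; apply: HC.
    by rewrite (le_lt_trans (ler_norm _))// ltrDl.
  by exists (p, u).
(* The upper bound for the inverse of G gives the lower bound for G; there is
   no minimum to take when n = 0, the sphere being empty. *)
have [C [C0 HC]] := bnd G (fun p u Kp _ => cG p u Kp).
have [D [D0 HD]] : exists C, 0 < C /\ forall p u, K p -> S u -> (G (p, u))^-1 <= C.
  apply: (bnd (fun x => (G x)^-1)) => p u Kp Su.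
  by apply: cvgV; [rewrite gt_eqF// pG// S0|exact: cG].
exists D^-1, C; split; rewrite ?invr_gt0// => p u Kp.
have [->|u0] := eqVneq u 0.
  have := @hG p 0 0 Kp (lexx 0).
  by rewrite scale0r mul0r => ->; rewrite normr0 !mulr0 lexx.
have nu : 0 < `|u| by rewrite normr_gt0.
have -> : G (p, u) = `|u| * G (p, `|u|^-1 *: u).
  by rewrite -hG ?ltW// scalerA divff ?gt_eqF// scale1r.
have Su : S (`|u|^-1 *: u).
  by rewrite /S /= normrZ ger0_norm ?invr_ge0// mulVf// gt_eqF.
rewrite ![_ * `|u|]mulrC !ler_pM2l//; apply/andP; split; last exact: HC.
by rewrite invf_ple ?posrE ?HD// pG// S0.
Qed.

Lemma le_normr_matrix (R : realType) (n : nat) (u : 'rV[R]_n) (l : R) :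
  0 <= l -> (forall j, `|u 0 j| <= l) -> `|u| <= l.
Proof.
move=> l0 H; have [->|u0] := eqVneq u 0; first by rewrite normr0.
have /mx_norm_neq0[[k j] /= E] : mx_norm u != 0.
  by apply: contra_neq u0; exact: mx_norm_eq0.
by rewrite [`|u|]E (ord1 k).
Qed.

Lemma coord_le_norm (R : realType) (n : nat) (u : 'rV[R]_n) j : `|u 0 j| <= `|u|.
Proof.
rewrite [leRHS]mx_normrE.
exact: (le_bigmax _ (fun k : 'I_1 * 'I_n => `|u k.1 k.2|) (0, j)).
Qed.

(** Derivatives as limits of quotients in the variable [t = s + h], the form used in
    [C1_path]. *)
Lemma difference_quotientP (R : realType) (V : normedModType R) (f : R -> V)
    (s : R) (l : V) :
  (t - s)^-1 *: (f t - f s) @[t --> s^'] --> l <->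
  derivable f s 1 /\ derive1 f s = l.
Proof.
have E : (fun h => h^-1 *: ((f \o shift s) (h *: 1) - f s)) =
         (fun h : R => h^-1 *: (f (h + s) - f s)).
  apply/funext => h /=; congr (_ *: (f (_ + _) - _)); exact: mulr1.
have up : (fun h : R => h + s) @ 0^' --> s^'.
  move=> W /= /nbhs_ballP[e /= e0 We]; apply/nbhs_ballP; exists e => //= h.
  rewrite /ball /= sub0r normrN => he h0; apply: We.
    by rewrite /ball /= opprD addrCA subrr addr0 normrN.
  by apply: contra_neq h0 => /(congr1 (fun z => z - s)); rewrite addrK subrr.
have dn : (fun t : R => t - s) @ s^' --> 0^'.
  move=> W /= /nbhs_ballP[e /= e0 We]; apply/nbhs_ballP; exists e => //= h.
  rewrite /ball /= => he h0; apply: We; last by rewrite subr_eq0.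
  by rewrite /ball /= sub0r opprB.
split=> [H|[df <-]].
  have H' : h^-1 *: (f (h + s) - f s) @[h --> 0^'] --> l.
    have := cvg_comp _ _ up H; apply: cvg_trans; apply: near_eq_cvg.
    by near=> h; rewrite /= addrK.
  split; first by apply/cvg_ex; exists l; rewrite E.
  exact: cvg_lim H'.
have : h^-1 *: (f (h + s) - f s) @[h --> 0^'] --> derive1 f s.
  by rewrite /derive1 -E; exact: df.
move=> /(cvg_comp _ _ dn); apply: cvg_trans; apply: near_eq_cvg.
by near=> h; rewrite /= subrK.
Unshelve. all: by end_near. Qed.

Lemma diff_retract_inj (R : realType) (V W : normedModType R) (f : V -> W)
    (g : W -> V) (p u : V) :
  differentiable f p -> differentiable g (f p) ->
  (\forall q \near p, (g \o f) q = q) -> 'd f p u = 0 -> u = 0.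
Proof.
move=> df dg gf fu0.
have <- : 'D_u (g \o f) p = u by rewrite (near_eq_derive _ gf) derive_id.
rewrite deriveE; last exact: differentiable_comp.
by rewrite (diff_comp df dg) /= fu0 linear0.
Qed.

Lemma derive1_comp_diff (R : realType) (V W : normedModType R) (f : V -> W)
    (g : R -> V) (s : R) :
  derivable g s 1 -> differentiable f (g s) ->
  derivable (f \o g) s 1 /\ derive1 (f \o g) s = 'd f (g s) (derive1 g s).
Proof.
move=> /derivable1_diffP dg df; have dfg := differentiable_comp dg df.
split; first exact/derivable1_diffP.
by rewrite !derive1E (deriveE _ dfg) (deriveE _ dg) (diff_comp dg df).
Qed.

Lemma within_nbhs_continuous (T U : topologicalType) (D : set T) (f : T -> U)
    (s : T) :
  {within D, continuous f} -> nbhs s D -> {for s, continuous f}.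
Proof.
move=> /subspace_continuousP cf Ds W fW.
have H : \forall t \near s, D t -> W (f t) := cf s (nbhs_singleton Ds) W fW.
suff : \forall t \near s, W (f t) by [].
by apply: filterS2 Ds H => t Dt; exact.
Qed.

Lemma itvoo_nbhs (R : realType) (a b s : R) : s \in `]a, b[ -> nbhs s [set` `[a, b]].
Proof.
move=> sab; apply: (@filterS _ _ _ [set` `]a, b[]).
  exact: subset_itv_oo_cc.
by apply: open_nbhs_nbhs; split => //; exact: itv_open.
Qed.

Lemma itv_split (R : realType) (a b c : R) : a <= c -> c <= b ->
  [set` `[a, b]] = [set` `[a, c]] `|` [set` `[c, b]] :> set R.
Proof.
move=> ac cb; apply/seteqP; split => t /=; rewrite !in_itv /=.
  by move=> /andP[-> ->]; rewrite andbT; exact/orP/le_total.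
move=> [/andP[-> tc]|/andP[ct ->]] /=; first exact: le_trans tc cb.
by rewrite andbT; exact: le_trans ac ct.
Qed.

Lemma cvge0P (R : realType) (u : nat -> \bar R) : (forall k, 0 <= u k)%E ->
  u k @[k --> \oo] --> 0%E <->
  forall e : R, 0 < e -> \forall k \near \oo, (u k < e%:E)%E.
Proof.
move=> u0; split=> [H e e0|H].
  have : nbhs (0%E : \bar R) [set y | (y < e%:E)%E].
    by apply: open_nbhs_nbhs; split; [exact: open_ereal_lt_ereal|rewrite /= lte_fin].
  exact: H.
apply/fine_cvgP; split.
  apply: filterS (H 1 ltr01) => k uk; rewrite ge0_fin_numE//.
  exact: lt_trans uk (ltry _).
apply/cvgrPdist_lt => e e0; apply: filterS (H e e0) => k uk.
rewrite sub0r normrN ger0_norm; last exact: fine_ge0.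
rewrite -lte_fin fineK// ge0_fin_numE//; exact: lt_trans uk (ltry _).
Qed.

(** * Charts and transition maps *)

Lemma chart_imgP (R : realType) (n : nat) (M : topologicalType)
    (c : chart R n M) (p : 'rV[R]_n) :
  chart_img c p -> chart_dom c (chart_inv c p) /\ c (chart_inv c p) = p.
Proof. by move=> [x dx <-]; rewrite chart_mapK. Qed.

Lemma chart_img_nbhs (R : realType) (n : nat) (M : topologicalType)
    (c : chart R n M) (x : M) :
  chart_dom c x -> nbhs (c x) (chart_img c).
Proof.
by move=> dx; apply: open_nbhs_nbhs; split; [exact: chart_img_open|exists x].
Qed.

Lemma open_overlap (R : realType) (n : nat) (M : topologicalType)
    (c c' : chart R n M) : open (c @` (chart_dom c `&` chart_dom c')).
Proof.
rewrite openE => _ [x [dx dx'] <-].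
rewrite /interior; near=> q.
have [dq eq] : chart_dom c (chart_inv c q) /\ c (chart_inv c q) = q.
  by apply: chart_imgP; near: q; exact: chart_img_nbhs.
exists (chart_inv c q) => //; split => //; near: q.
have cc : chart_inv c q @[q --> c x] --> x.
  by rewrite -[X in _ --> X](chart_mapK dx); apply: chart_inv_continuous; exists x.
by apply: cc; apply: open_nbhs_nbhs; split => //; exact: chart_dom_open.
Unshelve. all: by end_near. Qed.

Section transition_maps.
Variables (R : realType) (n : nat) (M : topologicalType).
Variable A : smooth_manifold R n M.
Implicit Types (i j : atlas_index A) (x : M).

Lemma chart_at_dom x : chart_dom (chart_at A x) x.
Proof. exact: (projT2 (cid (atlas_cover A x))). Qed.

Lemma transition_differentiable i j x :
  chart_dom (A i) x -> chart_dom (A j) x ->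
  differentiable (transition (A i) (A j)) (A i x).
Proof.
by move=> ix jx; have [+ _] := @atlas_smooth _ _ _ A i j 1%N; apply; exists x.
Qed.

Lemma transition_derive_continuous i j x (v : 'rV[R]_n) :
  chart_dom (A i) x -> chart_dom (A j) x ->
  {for A i x, continuous (fun p => 'D_v (transition (A i) (A j)) p)}.
Proof.
move=> ix jx; have [_ /(_ v) /=] := @atlas_smooth _ _ _ A i j 1%N.
by apply; exists x.
Qed.

Lemma transitionK i j x : chart_dom (A i) x -> chart_dom (A j) x ->
  \forall p \near A i x,
    (transition (A j) (A i) \o transition (A i) (A j)) p = p.
Proof.
move=> ix jx.
have /filterS : nbhs (A i x) (A i @` (chart_dom (A i) `&` chart_dom (A j))).
  by apply: open_nbhs_nbhs; split; [exact: open_overlap|exists x].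
apply => _ [y [iy jy] <-].
by rewrite /transition /= (chart_mapK iy) (chart_mapK jy).
Qed.

Lemma diff_transition_inj i j x (u : 'rV[R]_n) :
  chart_dom (A i) x -> chart_dom (A j) x ->
  'd (transition (A i) (A j)) (A i x) u = 0 -> u = 0.
Proof.
move=> ix jx; apply: (@diff_retract_inj _ _ _ _ (transition (A j) (A i))).
- exact: transition_differentiable.
- have -> : transition (A i) (A j) (A i x) = A j x.
    by rewrite /transition /= (chart_mapK ix).
  exact: transition_differentiable.
- exact: transitionK.
Qed.

Lemma bundle_coordE i x (u : 'rV[R]_n) :
  chart_dom (A i) x ->
  bundle_chart_inv i (A i x, u) =
  TangentVector x ('d (transition (A i) (chart_at A x)) (A i x) u).
Proof. by move=> dx; rewrite /bundle_chart_inv /= chart_mapK. Qed.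

End transition_maps.

(** * The Finsler structure in a chart *)

(** The function [F] in the bundle coordinates of the chart [A i]; it is meaningful
    when the point [pu.1] is in the image of the chart. *)
Definition finsler_coord (R : realType) (n : nat) (M : topologicalType)
    (A : smooth_manifold R n M) (F : tangent_bundle A -> R)
    (i : atlas_index A) (pu : 'rV[R]_n * 'rV[R]_n) : R :=
  F (bundle_chart_inv i pu).

Section coordinates.
Variables (R : realType) (n : nat) (M : topologicalType).
Variables (A : smooth_manifold R n M) (F : tangent_bundle A -> R).
Implicit Types (i j : atlas_index A) (x : M) (beta : R -> M).

(** [velocity] is defined through the preferred chart at [beta s]; this lemma computes
    the value of [F] on it in any chart around [beta s]. *)
Lemma finsler_velocity i beta (s : R) :
  (\forall t \near s, chart_dom (A i) (beta t)) ->
  derivable (A i \o beta) s 1 ->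
  F (TangentVector (beta s) (velocity A beta s)) =
  finsler_coord F i (A i (beta s), derive1 (A i \o beta) s).
Proof.
move=> ib db; have is_ := nbhs_singleton ib.
rewrite /finsler_coord bundle_coordE//; congr (F (TangentVector _ _)).
rewrite /velocity; set k := chart_at A (beta s).
rewrite derive1E.
have kE : \forall t \near s, (k \o beta) t = (transition (A i) k \o (A i \o beta)) t.
  by apply: filterS ib => t it; rewrite /transition /= chart_mapK.
rewrite (near_eq_derive _ kE) -!derive1E.
apply: (derive1_comp_diff db _).2; apply: transition_differentiable => //.
exact: chart_at_dom.
Qed.

Hypothesis hF : finsler_structure F.

Lemma finsler_coord_continuous i p u : chart_img (A i) p ->
  {for (p, u), continuous (finsler_coord F i)}.
Proof.
move=> ip W /nbhs_interior oW.
have FW : open (F @^-1` W^°).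
  by apply: open_comp (open_interior W) => v _; exact: finsler_continuous.
have : nbhs (p, u) (chart_img (A i) `*` setT `&` bundle_chart_inv i @^-1` (F @^-1` W^°)).
  by apply: open_nbhs_nbhs; split; [exact: FW|split => //; exact: nbhs_singleton oW].
by apply: filterS => q [_]; exact: interior_subset.
Qed.

Lemma finsler_coord_gt0 i p u : chart_img (A i) p -> u != 0 ->
  0 < finsler_coord F i (p, u).
Proof.
move=> [x ix <-] u0; rewrite lt_neqAle finsler_ge0// andbT eq_sym.
apply: contra u0 => /eqP; rewrite /finsler_coord bundle_coordE//.
move=> /(finsler_eq0 hF) H; apply/eqP.
exact: (diff_transition_inj ix (chart_at_dom A x)).
Qed.

Lemma finsler_coordZ i p u l : 0 <= l ->
  finsler_coord F i (p, l *: u) = l * finsler_coord F i (p, u).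
Proof.
move=> l0; rewrite /finsler_coord /bundle_chart_inv /= linearZ.
exact: finsler_homogeneous.
Qed.

Lemma finsler_dist_ge0 x y : (0 <= finsler_dist F x y)%E.
Proof.
apply: le_ereal_inf_tmp => _ [a [b [beta [_ _ _ ->]]]].
by apply: integral_ge0 => s _; rewrite lee_fin (finsler_ge0 hF).
Qed.

End coordinates.

(** * Segments in a chart *)

Section segment.
Variables (R : realType) (n : nat) (M : topologicalType).
Variables (A : smooth_manifold R n M) (F : tangent_bundle A -> R).
Implicit Types (i j : atlas_index A) (x y : M).

(** The path whose coordinates in the chart [A i] are those of the line through [p]
    with direction [v]; it is meaningful while this line is in the image of the
    chart. *)
Definition chart_line i (p v : 'rV[R]_n) (t : R) : M :=
  chart_inv (A i) (p + t *: v).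

Lemma is_derive_line (p v : 'rV[R]_n) (t : R) :
  derivable (fun t : R => p + t *: v) t 1 /\ derive1 (fun t : R => p + t *: v) t = v.
Proof.
apply/difference_quotientP; apply: cvg_near_cst.
near=> z; rewrite opprD addrACA subrr add0r -scalerBl scalerA mulVf ?scale1r//.
by rewrite subr_eq0; near: z; exact: nbhs_dnbhs_neq.
Unshelve. all: by end_near. Qed.

Lemma line_continuous (p v : 'rV[R]_n) : continuous (fun t : R => p + t *: v).
Proof.
by move=> t; apply: cvgD; [exact: cvg_cst|apply: cvgZr_tmp; exact: cvg_id].
Qed.

Lemma transition_line i j p v t (x := chart_line i p v t) :
  chart_img (A i) (p + t *: v) -> chart_dom (A j) x ->
  derivable (A j \o chart_line i p v) t 1 /\
  derive1 (A j \o chart_line i p v) t =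
    'D_v (transition (A i) (A j)) (p + t *: v).
Proof.
move=> ip jx; have [ix xE] := chart_imgP ip.
have dtr : differentiable (transition (A i) (A j)) (p + t *: v).
  by rewrite -xE; exact: transition_differentiable.
have [dl lE] := is_derive_line p v t.
have [? E] := derive1_comp_diff dl dtr.
by split => //; rewrite deriveE// -[X in 'd _ _ X]lE -E.
Qed.

Lemma chart_line_C1 i (p v : 'rV[R]_n) (a b : R) :
  (forall t, t \in `[a, b] -> chart_img (A i) (p + t *: v)) ->
  C1_path A a b (chart_line i p v).
Proof.
move=> ip; split.
  apply: continuous_in_subspaceT => t; rewrite inE /= => tab.
  apply: (@continuous_comp _ _ _ (fun t : R => p + t *: v) (chart_inv (A i))).
    exact: line_continuous.
  by apply: chart_inv_continuous; exact: ip.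
move=> j; exists (fun t => 'D_v (transition (A i) (A j)) (p + t *: v)) => D.
split.
  apply: continuous_in_subspaceT => t; rewrite inE => -[/= tab jt].
  have [it tE] := chart_imgP (ip _ tab).
  apply: (@continuous_comp _ _ _ (fun t : R => p + t *: v)
    (fun p => 'D_v (transition (A i) (A j)) p)); first exact: line_continuous.
  by rewrite -tE; exact: transition_derive_continuous.
move=> t [/= tab jt]; apply: cvg_within_filter.
exact/difference_quotientP/transition_line/jt/ip.
Qed.

Lemma finsler_chart_line i (p v : 'rV[R]_n) t :
  chart_img (A i) (p + t *: v) ->
  F (TangentVector _ (velocity A (chart_line i p v) t)) =
  finsler_coord F i (p + t *: v, v).
Proof.
move=> ip; have [it tE] := chart_imgP ip.
have near_img : \forall z \near t, chart_img (A i) (p + z *: v).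
  apply: (@line_continuous p v t); rewrite -tE; exact: chart_img_nbhs.
have near_line : \forall z \near t, p + z *: v = (A i \o chart_line i p v) z.
  by apply: filterS near_img => z /chart_imgP[].
have [dl lE] := is_derive_line p v t.
rewrite (@finsler_velocity _ _ _ _ _ i).
- rewrite [in LHS]/chart_line tE; congr (finsler_coord _ _ (_, _)).
  by rewrite -[RHS]lE !derive1E; apply/esym/near_eq_derive.
- by apply: filterS near_img => z /chart_imgP[].
- exact: near_eq_derivable near_line dl.
Qed.

Hypothesis hF : finsler_structure F.

Lemma finsler_dist_le_line i x y (K : set 'rV[R]_n) (C : R) :
  0 <= C -> chart_dom (A i) x -> chart_dom (A i) y -> K `<=` chart_img (A i) ->
  (forall t, t \in `[0, 1] -> K (A i x + t *: (A i y - A i x))) ->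
  (forall p u, K p -> finsler_coord F i (p, u) <= C * `|u|) ->
  (finsler_dist F x y <= (C * `|A i y - A i x|)%:E)%E.
Proof.
move=> C0 ix iy Ki Kl KC; set v := A i y - A i x.
have li t : t \in `[0, 1] -> chart_img (A i) (A i x + t *: v).
  by move=> t01; apply: Ki; exact: Kl.
apply: (@le_trans _ _ (path_length F 0 1 (chart_line i (A i x) v))).
  apply: ereal_inf_lbound; exists 0, 1, (chart_line i (A i x) v).
  split => //.
  - exists [:: 1]; split; first exact: itv_partition1.
    by move=> [|//] _ /=; exact: chart_line_C1.
  - by rewrite /chart_line scale0r addr0 chart_mapK.
  - by rewrite /chart_line scale1r addrC subrK chart_mapK.
rewrite /path_length.
have -> : (\int[@lebesgue_measure R]_(t in `[0%R, 1%R]) (F (TangentVector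
      (chart_line i (A i x) v t) (velocity A (chart_line i (A i x) v) t)))%:E =
    \int[@lebesgue_measure R]_(t in `[0%R, 1%R])
      (finsler_coord F i (A i x + t *: v, v))%:E)%E.
  apply: eq_integral => t; rewrite inE /= => t01.
  by rewrite finsler_chart_line//; exact: li.
have -> : (C * `|v|)%:E =
    (\int[@lebesgue_measure R]_(s in `[0%R, 1%R]) (C * `|v|)%:E)%E.
  rewrite integral_cst//= lebesgue_measure_itv/= lte01.
  by rewrite -EFinD subr0 mule1.
apply: ge0_le_integral => //.
- by move=> t _; rewrite lee_fin (finsler_ge0 hF).
- apply/measurable_EFinP; apply: subspace_continuous_measurable_fun => //.
  apply: continuous_in_subspaceT => t; rewrite inE /= => t01.
  apply: (@continuous_comp _ _ _ (fun t : R => (A i x + t *: v, v)) (finsler_coord F i)).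
    exact: (cvg_pair (@line_continuous (A i x) v t) (cvg_cst v)).
  by apply: finsler_coord_continuous => //; exact: li.
- by move=> t /= t01; rewrite lee_fin; apply: KC; exact: Kl.
Qed.

End segment.

(** * Speed of piecewise C^1 paths *)

Lemma piecewise_C1_cons (R : realType) (n : nat) (M : topologicalType)
    (A : smooth_manifold R n M) (a b c : R) (s : seq R) (beta : R -> M) :
  (forall k, (k < size (c :: s))%N ->
    C1_path A (nth b [:: a, c & s] k) (nth b [:: a, c & s] k.+1) beta) ->
  C1_path A a c beta /\
  (forall k, (k < size s)%N ->
    C1_path A (nth b (c :: s) k) (nth b (c :: s) k.+1) beta).
Proof. by move=> H; split=> [|k ks]; [exact: (H 0%N)|exact: (H k.+1)]. Qed.

Section speed_of_paths.
Variables (R : realType) (n : nat) (M : topologicalType).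
Variables (A : smooth_manifold R n M) (F : tangent_bundle A -> R).
Implicit Types (i j : atlas_index A) (x : M) (beta : R -> M).

Lemma C1_pathW (a b u w : R) beta :
  a <= u -> w <= b -> C1_path A a b beta -> C1_path A u w beta.
Proof.
move=> au wb [cb db].
have uwab : [set` `[u, w]] `<=` [set` `[a, b]] by apply: subset_itv; rewrite bnd_simp.
split; first exact: continuous_subspaceW cb.
move=> i; have [g [cg dg]] := db i; exists g => D.
have DD : D `<=` [set` `[a, b]] `&` beta @^-1` chart_dom (A i).
  by move=> t [tuw it]; split => //; exact: uwab.
split; first exact: continuous_subspaceW cg.
move=> s Ds; apply: cvg_trans (dg s (DD s Ds)).
by apply: cvg_app; exact: within_subset.
Qed.

(** At the interior times spent in the domain of the chart [A i], a C^1 path has a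
    derivative in this chart. It agrees with a function [g] that is continuous
    within the set of all times spent there, end points [a] and [b] included. *)
Lemma C1_path_chart (a b : R) beta i : C1_path A a b beta ->
  exists g : R -> 'rV[R]_n,
    {within [set` `[a, b]] `&` beta @^-1` chart_dom (A i), continuous g} /\
    forall s, s \in `]a, b[ -> chart_dom (A i) (beta s) ->
    [/\ \forall t \near s, chart_dom (A i) (beta t),
        {for s, continuous g},
        derivable (A i \o beta) s 1 &
        derive1 (A i \o beta) s = g s].
Proof.
move=> [cb db]; have [g [cg dg]] := db i; exists g; split => // s sab is_.
have cbs : {for s, continuous beta}.
  by apply: within_nbhs_continuous cb _; exact: itvoo_nbhs.
have near_dom : \forall t \near s, chart_dom (A i) (beta t).
  by apply: cbs; apply: open_nbhs_nbhs; split => //; exact: chart_dom_open.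
set D := [set` `[a, b]] `&` beta @^-1` chart_dom (A i).
have sD : nbhs s D by apply: filterI => //; exact: itvoo_nbhs.
have [] // : derivable (A i \o beta) s 1 /\ derive1 (A i \o beta) s = g s.
  apply/difference_quotientP; apply: cvg_trans (dg s (nbhs_singleton sD)).
  by apply: cvg_app => W WD; apply: filterS2 sD WD => t Dt Ht ts; exact: Ht.
by split => //; exact: within_nbhs_continuous cg _.
Qed.

Lemma piecewise_C1_continuous (a b : R) beta :
  piecewise_C1_path A a b beta -> {within `[a, b], continuous beta}.
Proof.
move=> [s [abs]]; elim: s a abs => [|c s IH] a abs.
  move=> _; rewrite (itv_partition_nil abs) set_itv1; exact: continuous_subspace1.
move=> /piecewise_C1_cons[[cac _] Ccb].
have cbs := itv_partition_cons abs.
have ac : a < c by have [/= /andP[]] := abs.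
rewrite (itv_split (ltW ac) (itv_partition_le cbs)).
by apply: withinU_continuous => //; [exact: interval_closed..|exact: IH].
Qed.

(** The integrand of [path_length]. *)
Definition speed beta (s : R) : R := F (TangentVector (beta s) (velocity A beta s)).

Hypothesis hF : finsler_structure F.

Lemma speed_continuous (a b s : R) beta :
  C1_path A a b beta -> s \in `]a, b[ -> {for s, continuous (speed beta)}.
Proof.
move=> Cb sab; have [i is_] := atlas_cover A (beta s).
have [g [_ Hg]] := C1_path_chart i Cb.
have [near_dom cg dbs bE] := Hg s sab is_.
(* A single chart computes the speed at all times near s, although the preferred
   chart at beta t may vary with t. *)
have near_speed : \forall t \near s,
    finsler_coord F i ((A i \o beta) t, g t) = speed beta t.
  have : nbhs s [set` `]a, b[].
    by apply: open_nbhs_nbhs; split => //; exact: itv_open.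
  apply: filterS2 near_dom => t it tab.
  have [ndt _ dt gE] := Hg t tab it.
  by rewrite /speed (finsler_velocity F ndt dt) gE.
have cF : {for s, continuous (fun t => finsler_coord F i ((A i \o beta) t, g t))}.
  apply: (@continuous_comp _ _ _ (fun t => ((A i \o beta) t, g t)) (finsler_coord F i)).
    have cb : {for s, continuous (A i \o beta)}.
      by apply: differentiable_continuous; exact/derivable1_diffP.
    exact: (cvg_pair cb cg).
  by apply: finsler_coord_continuous => //; exists (beta s).
rewrite /prop_for /continuous_at -(nbhs_singleton near_speed).
apply: cvg_trans cF; apply: near_eq_cvg; exact: near_speed.
Qed.

Lemma measurable_speed (a b : R) beta :
  C1_path A a b beta -> measurable_fun `[a, b] (speed beta).
Proof.
move=> Cb; apply: (@measurable_fun_itv_cc _ _ _ false true).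
apply: open_continuous_measurable_fun.
  exact: itv_open.
by move=> s; rewrite inE /= => sab; exact: speed_continuous Cb sab.
Qed.

Lemma piecewise_C1_measurable (a b : R) beta :
  piecewise_C1_path A a b beta -> measurable_fun `[a, b] (speed beta).
Proof.
move=> [s [abs]]; elim: s a abs => [|c s IH] a abs.
  by move=> _; rewrite (itv_partition_nil abs) set_itv1; exact: measurable_fun_set1.
move=> /piecewise_C1_cons[Cac Ccb].
have cbs := itv_partition_cons abs.
have ac : a < c by have [/= /andP[]] := abs.
rewrite (itv_split (ltW ac) (itv_partition_le cbs)).
apply/measurable_funU => //; split; first exact: measurable_speed.
exact: IH.
Qed.

End speed_of_paths.

(** * Lower bound for the length *)

Section length_lower_bound.
Variables (R : realType) (n : nat) (M : topologicalType).
Variables (A : smooth_manifold R n M) (F : tangent_bundle A -> R).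
Hypothesis hF : finsler_structure F.
Variables (i : atlas_index A) (m : R) (K : set M).
Hypotheses (m_gt0 : 0 < m) (K_dom : K `<=` chart_dom (A i)).
Hypothesis K_norm : forall x u, K x -> m * `|u| <= finsler_coord F i (A i x, u).
Implicit Type beta : R -> M.
Local Notation mu := (@lebesgue_measure R).
Local Notation speed := (speed F).

(** The fundamental theorem of calculus for the coordinate [j] of the path: as the
    speed is at least [m] times the absolute value of the derivative of this
    coordinate, the length is at least [m] times its variation. *)
Lemma C1_path_length_ge_coord (a b : R) beta (j : 'I_n) :
  a < b -> C1_path A a b beta -> (forall t, t \in `[a, b] -> K (beta t)) ->
  ((m * `|A i (beta b) 0 j - A i (beta a) 0 j|)%:E <=
   \int[mu]_(s in `[a, b]) (speed beta s)%:E)%E.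
Proof.
move=> ab Cb Kb; have [g [cg Hg]] := C1_path_chart i Cb.
have cgj : {within `[a, b], continuous (fun t => g t 0 j)}.
  have : {within `[a, b], continuous g}.
    apply: continuous_subspaceW cg => t tab; split => //.
    exact/K_dom/Kb.
  move=> cg' t.
  apply: (@continuous_comp _ _ _ (g : subspace _ -> _)
    (fun u : 'rV[R]_n => u 0 j)).
    exact: cg'.
  exact: coord_continuous.
have mg : measurable_fun `[a, b] (fun t => (g t 0 j)%:E).
  apply/measurable_EFinP.
  exact: subspace_continuous_measurable_fun.
pose gam t := A i (beta t) 0 j.
have cgam : {within `[a, b], continuous gam}.
  have [/subspace_continuousP cb _] := Cb.
  apply/subspace_continuousP => t tab.
  have cA : {for beta t, continuous (A i)}.
    by apply: chart_map_continuous; exact/K_dom/Kb.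
  have := cvg_comp _ _ (cvg_comp _ _ (cb t tab) cA) (@coord_continuous _ _ _ 0 j _).
  exact.
have gE : (\int[mu]_(t in `[a, b]) (g t 0 j)%:E = (gam b)%:E - (gam a)%:E)%E.
  have dg t : t \in `]a, b[ -> derivable gam t 1 /\ derive1 gam t = g t 0 j.
    move=> tab; have [] := Hg t tab.
      by apply/K_dom/Kb; apply: subset_itv_oo_cc.
    move=> _ _ dt dE; apply/difference_quotientP.
    have /(cvg_comp _ _) := (difference_quotientP _ _ _).2 (conj dt dE).
    move=> /(_ _ _ _ (@coord_continuous _ _ _ 0 j _)).
    by apply: cvg_trans; apply: near_eq_cvg; near=> z; rewrite /gam /= !mxE.
  apply: continuous_FTC2 => //; last by move=> t tab; rewrite (dg t tab).2.
  have [_ ca cb] := (continuous_within_itvP gam ab).1 cgam.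
  by split => // t tab; exact: (dg t tab).1.
have -> : (m * `|A i (beta b) 0 j - A i (beta a) 0 j|)%:E =
    (m%:E * `|\int[mu]_(t in `[a, b]) (g t 0 j)%:E|)%E.
  by rewrite gE.
apply: (@le_trans _ _ (m%:E * \int[mu]_(t in `[a, b]) `|(g t 0 j)%:E|)%E).
  by rewrite lee_pmul2l ?lte_fin//; exact: le_abse_integral.
have mag := measurableT_comp (@abse_measurable R setT) mg.
rewrite -ge0_integralZl_EFin//; last exact: ltW.
have mspeed : measurable_fun `[a, b] (fun t => (speed beta t)%:E).
  by apply/measurable_EFinP; exact: (measurable_speed hF Cb).
(* The velocity is only known at interior times, so the integrands are compared
   on the open interval. *)
have oc : `]a, b[%classic `<=` [set` `[a, b]] by exact: subset_itv_oo_cc.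
have mmag : measurable_fun `[a, b] (fun t => m%:E * `|(g t 0 j)%:E|)%E.
  by apply: measurable_funeM.
have mmago := measurable_funS (measurable_itv `[a, b]) oc mmag.
have mspeedo := measurable_funS (measurable_itv `[a, b]) oc mspeed.
rewrite (integral_itv_bndoo true false mmago) (integral_itv_bndoo true false mspeedo).
apply: ge0_le_integral => //.
- by move=> t _; rewrite mule_ge0// lee_fin ltW.
- move=> t /= tab; have tK : K (beta t) by apply: Kb; exact: subset_itv_oo_cc.
  have [ndt _ dt dE] := Hg t tab (K_dom tK).
  rewrite -EFinM lee_fin /speed (finsler_velocity F ndt dt) dE.
  apply: le_trans (K_norm _ tK); rewrite ler_pM2l//; exact: coord_le_norm.
Unshelve. all: by end_near. Qed.

(** Since the norm on R^n is the maximum norm, the coordinatewise bounds suffice. *)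
Lemma C1_path_length_ge (a b : R) beta :
  a <= b -> C1_path A a b beta -> (forall t, t \in `[a, b] -> K (beta t)) ->
  ((m * `|A i (beta b) - A i (beta a)|)%:E <=
   \int[mu]_(s in `[a, b]) (speed beta s)%:E)%E.
Proof.
move=> ab Cb Kb.
have L0 : (0 <= \int[mu]_(s in `[a, b]) (speed beta s)%:E)%E.
  by apply: integral_ge0 => t _; rewrite lee_fin (finsler_ge0 hF).
have [ba|nab] := eqVneq b a; first by subst b; rewrite subrr normr0 mulr0.
have {nab}ab : a < b by rewrite lt_neqAle eq_sym nab.
have H j := C1_path_length_ge_coord j ab Cb Kb.
move: L0 H; case: (\int[mu]_(s in `[a, b]) (speed beta s)%:E)%E => [l| |] L0 H.
- move: L0; rewrite !lee_fin => L0; rewrite mulrC -ler_pdivlMr//.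
  apply: le_normr_matrix; first by apply: divr_ge0 => //; exact: ltW.
  by move=> j; rewrite ler_pdivlMr// mulrC; have := H j; rewrite lee_fin !mxE.
- by rewrite leey.
- by [].
Qed.

(** Only the part of the path over [[u, w]] has to stay in [K]. *)
Lemma subpath_length_ge (a b u w : R) beta :
  piecewise_C1_path A a b beta -> a <= u -> u <= w -> w <= b ->
  (forall t, t \in `[u, w] -> K (beta t)) ->
  ((m * `|A i (beta w) - A i (beta u)|)%:E <= path_length F a b beta)%E.
Proof.
rewrite /path_length -/(speed beta) => -[s [abs]].
elim: s a u abs => [|c s IH] a u abs.
  move=> _ au uw wb _.
  have -> : u = w.
    by apply/eqP; rewrite eq_le uw (le_trans wb)// -(itv_partition_nil abs).
  rewrite subrr normr0 mulr0.
  by apply: integral_ge0 => t _; rewrite lee_fin (finsler_ge0 hF).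
move=> Cs au uw wb Kb; have [Cac Ccb] := piecewise_C1_cons Cs.
have cbs := itv_partition_cons abs.
have ac : a < c by have [/= /andP[]] := abs.
have cb := itv_partition_le cbs.
have mab : measurable_fun `[a, b] (fun t => (speed beta t)%:E).
  apply/measurable_EFinP.
  by apply: (piecewise_C1_measurable hF); exists (c :: s).
have sp0 D t : D t -> (0%R <= (speed beta t)%:E)%E.
  by move=> _; rewrite lee_fin (finsler_ge0 hF).
have int_le u' w' : a <= u' -> w' <= b ->
    (\int[mu]_(s in `[u', w']) (speed beta s)%:E <=
     \int[mu]_(s in `[a, b]) (speed beta s)%:E)%E.
  move=> au' wb'; apply: ge0_subset_integral => //; first exact: sp0.
  by apply: subset_itv; rewrite bnd_simp.
have [wc|cw] := leP w c.
  apply: le_trans (int_le u w au wb).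
  by apply: C1_path_length_ge => //; apply: C1_pathW Cac.
have [cu|uc] := leP c u.
  by apply: le_trans (int_le c b (ltW ac) (lexx _)); exact: IH.
have mac : measurable_fun `[a, c] (fun t => (speed beta t)%:E).
  by apply: measurable_funS mab => //; apply: subset_itv; rewrite bnd_simp.
have mcb : measurable_fun `]c, b] (fun t => (speed beta t)%:E).
  apply: measurable_funS mab => //; apply: subset_itv; rewrite bnd_simp//.
  exact: ltW.
have split_int : (\int[mu]_(s in `[a, b]) (speed beta s)%:E =
    \int[mu]_(s in `[a, c]) (speed beta s)%:E +
    \int[mu]_(s in `[c, b]) (speed beta s)%:E)%E.
  have E : [set` `[a, b]] = [set` `[a, c]] `|` [set` `]c, b]].
    by apply: itv_bndbnd_setU; rewrite bnd_simp// ltW.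
  rewrite E ge0_integral_setU//.
  - by rewrite integral_itv_obnd_cbnd.
  - by rewrite -E.
  - by move=> t Dt; exact: (sp0 _ _ Dt).
  - apply/disj_setPS => t [] /=; rewrite !in_itv /= => /andP[_ tc] /andP[ct _].
    by move: (lt_le_trans ct tc); rewrite ltxx.
rewrite split_int.
have le1 : ((m * `|A i (beta c) - A i (beta u)|)%:E <=
    \int[mu]_(s in `[a, c]) (speed beta s)%:E)%E.
  apply: (@le_trans _ _ (\int[mu]_(s in `[u, c]) (speed beta s)%:E)%E).
    apply: C1_path_length_ge; first exact: ltW.
      exact: C1_pathW Cac.
    move=> t tuc; apply: Kb; apply: subset_itvl tuc; rewrite bnd_simp; exact: ltW.
  apply: ge0_subset_integral => //; first exact: sp0.
  by apply: subset_itv; rewrite bnd_simp.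
have le2 : ((m * `|A i (beta w) - A i (beta c)|)%:E <=
    \int[mu]_(s in `[c, b]) (speed beta s)%:E)%E.
  apply: IH => //; first exact: ltW.
  by move=> t tcw; apply: Kb; apply: subset_itvr tcw; rewrite bnd_simp; exact: ltW.
apply: le_trans (leeD le1 le2); rewrite -EFinD lee_fin -mulrDr ler_pM2l//.
have -> : A i (beta w) - A i (beta u) =
    (A i (beta c) - A i (beta u)) + (A i (beta w) - A i (beta c)).
  by rewrite [RHS]addrC addrA subrK.
exact: ler_normD.
Qed.

End length_lower_bound.

(** * Leaving an open set *)

Lemma within_closed_preimage (R : realType) (M : topologicalType) (a b : R)
    (beta : R -> M) (C : set M) :
  {within `[a, b], continuous beta} -> closed C ->
  exists2 V : set R, closed V &
    V `&` [set` `[a, b]] = beta @^-1` C `&` [set` `[a, b]].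
Proof.
move=> /continuous_closedP cb /cb; exact: (closed_subspaceP _ _).1.
Qed.

Section exit.
Variables (R : realType) (M : topologicalType) (U K : set M).
Hypotheses (oU : open U) (cK : closed K) (UK : U `<=` K).

(** The first exit time [t] is the minimum of the compact set of times at which the
    path is outside [U]; at time [t] itself the path is in [K] because [K] is
    closed. *)
Lemma first_exit (a b : R) (beta : R -> M) :
  a <= b -> {within `[a, b], continuous beta} -> U (beta a) -> ~ U (beta b) ->
  exists t, [/\ t \in `[a, b], ~ U (beta t) &
    forall s, s \in `[a, t] -> K (beta s)].
Proof.
move=> ab cb Ua nUb.
have [V cV VE] := within_closed_preimage cb (open_closedC oU).
have [W cW WE] := within_closed_preimage cb cK.
have VP t : t \in `[a, b] -> V t <-> ~ U (beta t).
  move=> tab; have := congr1 (fun X => X t) VE; rewrite /setI /= tab.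
  by rewrite !propeqE => -[H1 H2]; split=> H; [case: H1|case: H2].
have WP t : t \in `[a, b] -> W t <-> K (beta t).
  move=> tab; have := congr1 (fun X => X t) WE; rewrite /setI /= tab.
  by rewrite !propeqE => -[H1 H2]; split=> H; [case: H1|case: H2].
have cS : compact (V `&` [set` `[a, b]]).
  apply: subclosed_compact (@segment_compact _ a b) _; last by move=> t [].
  by apply: closedI => //; exact: interval_closed.
have S0 : V `&` [set` `[a, b]] !=set0.
  by exists b; split; rewrite /= ?bound_itvE//; apply/VP; rewrite ?bound_itvE.
have [t + tmin] := compact_EVT_min S0 cS (@continuous_subspaceT _ _ _ id (fun _ => cvg_id)).
rewrite inE => -[Vt tab]; exists t; split => //; first exact/VP.
have Wlt s : s \in `[a, b] -> s < t -> W s.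
  move=> sab st; apply/WP => //; apply: UK; apply: contrapT => nU.
  have : t <= s by apply: tmin; rewrite inE; split => //; exact/VP.
  by rewrite leNgt st.
have at_ : a < t.
  move: (tab); rewrite /= in_itv /= => /andP[at_ tb]; rewrite lt_neqAle at_ andbT.
  by apply/eqP => aE; move/(VP _ tab): Vt; rewrite -aE.
have tb : t <= b by move: (tab); rewrite /= in_itv /= => /andP[].
move=> s; rewrite in_itv /= => /andP[as_ st].
have sab : s \in `[a, b] by rewrite in_itv /= as_ (le_trans st).
apply/WP => //; move: st; rewrite le_eqVlt => /orP[/eqP ->|]; last exact: Wlt.
apply: cW => B /nbhs_ballP[e /= e0 eB].
pose z := Num.max a (t - e / 2).
have zt : z < t by rewrite gt_max at_ ltrBlDr ltrDl divr_gt0.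
exists z; split; first apply: Wlt => //.
  by rewrite in_itv /= le_max lexx (le_trans (ltW zt)).
apply: eB; rewrite /ball /= ger0_norm ?subr_ge0 ?ltW// ltrBlDr -ltrBlDl.
by rewrite lt_max ltrD2l ltrN2 gtr_pMr// invf_lt1// ltr1n orbT.
Qed.

Lemma last_entrance (a b : R) (beta : R -> M) :
  a <= b -> {within `[a, b], continuous beta} -> ~ U (beta a) -> U (beta b) ->
  exists t, [/\ t \in `[a, b], ~ U (beta t) &
    forall s, s \in `[t, b] -> K (beta s)].
Proof.
move=> ab cb nUa Ub.
(* The last entrance time is the first exit time of the reversed path. *)
have [||||t [tab nUt Kt]] := @first_exit (- b) (- a) (beta \o -%R).
- by rewrite lerN2.
- move/subspace_continuousP : cb => cb; apply/subspace_continuousP => t tab.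
  have tab' : [set` `[a, b]] (- t) by move: tab; rewrite /= oppr_itvcc.
  move=> W WN; have H : \forall s \near - t, s \in `[a, b] -> W (beta s) := cb _ tab' W WN.
  suff : \forall s \near t, s \in `[- b, - a] -> W (beta (- s)) by [].
  have oc : {for t, continuous (-%R : R -> R)} by exact: opp_continuous.
  have : \forall s \near t, - s \in `[a, b] -> W (beta (- s)) := oc _ H.
  by apply: filterS => s Hs sab; apply: Hs; rewrite oppr_itvcc ?opprK.
- by rewrite /= opprK.
- by rewrite /= opprK.
exists (- t); split => //; first by rewrite oppr_itvcc ?opprK.
by move=> s st; rewrite -(opprK s); apply: Kt; rewrite oppr_itvcc ?opprK.
Qed.

End exit.

(** * Distance and manifold topology *)

Section ball.
Variables (R : realType) (n : nat) (M : topologicalType).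
Variables (A : smooth_manifold R n M) (F : tangent_bundle A -> R).
Implicit Types (i : atlas_index A) (x y z : M) (r : R).

(** The points whose coordinates in [A i] are at distance less than [r] from those of
    [x]. *)
Definition chart_ball i x r : set M :=
  [set z | chart_dom (A i) z /\ `|A i z - A i x| < r].

(** The points whose coordinates in [A i] are at distance at most [r] from those of
    [x]. *)
Definition chart_closed_ball i x r : set M :=
  [set z | chart_dom (A i) z /\ `|A i z - A i x| <= r].

Lemma chart_ball_open i x r : open (chart_ball i x r).
Proof.
rewrite openE => z [iz zr]; rewrite /interior.
have dz : \forall y \near z, chart_dom (A i) y.
  by apply: open_nbhs_nbhs; split => //; exact: chart_dom_open.
have bz : \forall y \near z, `|A i y - A i x| < r.
  have : {for z, continuous (fun y => `|A i y - A i x|)}.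
    have cA : {for z, continuous (A i)} by exact: chart_map_continuous.
    exact: cvg_norm (cvgB cA (cvg_cst (A i x))).
  by move=> /(_ [set t | t < r]); apply; exact: lt_nbhsl.
by apply: filterS2 dz bz.
Qed.

Lemma chart_closed_ball_closed i x r :
  [set p | `|p - A i x| <= r] `<=` chart_img (A i) ->
  closed (chart_closed_ball i x r).
Proof.
move=> Bi; apply: compact_closed; first exact: manifold_hausdorff A.
have -> : chart_closed_ball i x r =
    chart_inv (A i) @` [set p | `|p - A i x| <= r].
  apply/seteqP; split => [z [iz zr]|_ [p pr <-]].
    by exists (A i z) => //; exact: chart_mapK.
  by have [? E] := chart_imgP (Bi p pr); split; rewrite ?E.
apply: continuous_compact; last exact: norm_ball_compact.
apply: continuous_in_subspaceT => p; rewrite inE => /Bi ip.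
exact: chart_inv_continuous.
Qed.

Hypothesis hF : finsler_structure F.

(** A bound with constant [m] on a closed ball holds on the smaller ones, so this
    lemma also applies, with the same [m], to every smaller radius [r]. *)
Lemma finsler_dist_lt_ball i x y r m :
  0 < r -> 0 < m -> chart_dom (A i) x ->
  [set p | `|p - A i x| <= r] `<=` chart_img (A i) ->
  (forall p u, `|p - A i x| <= r -> m * `|u| <= finsler_coord F i (p, u)) ->
  (finsler_dist F x y < (m * r)%:E \/ finsler_dist F y x < (m * r)%:E)%E ->
  chart_ball i x r y.
Proof.
move=> r0 m0 ix Bi Bm H; apply: contrapT => nUy.
have oU := @chart_ball_open i x r.
have cK := chart_closed_ball_closed Bi.
have UK : chart_ball i x r `<=` chart_closed_ball i x r.
  by move=> z [iz /ltW zr].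
have Ux : chart_ball i x r x by split => //; rewrite subrr normr0.
have Kd : chart_closed_ball i x r `<=` chart_dom (A i) by move=> z [].
have Km z u : chart_closed_ball i x r z -> m * `|u| <= finsler_coord F i (A i z, u).
  by move=> [_ zr]; exact: Bm.
have far z : chart_closed_ball i x r z -> ~ chart_ball i x r z -> r <= `|A i z - A i x|.
  by move=> [iz _] nU; rewrite leNgt; apply/negP => zr; exact: nU.
have ab_le a b beta : piecewise_C1_path A a b beta -> a <= b.
  by move=> [s [/itv_partition_le]].
case: H => /ereal_inf_lt[_ [a [b [beta [Pb ba bb ->]]]]]; rewrite ltNge => /negP; apply.
- have Ua : chart_ball i x r (beta a) by rewrite ba.
  have nUb : ~ chart_ball i x r (beta b) by rewrite bb.
  have [t [tab nU Kt]] := first_exit oU cK UK (ab_le _ _ _ Pb)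
    (piecewise_C1_continuous Pb) Ua nUb.
  move: (tab); rewrite in_itv /= => /andP[at_ tb].
  apply: le_trans (subpath_length_ge hF m0 Kd Km Pb (lexx a) at_ tb Kt).
  rewrite lee_fin ler_pM2l// ba; apply: far => //.
  by apply: Kt; rewrite in_itv /= at_ lexx.
- have nUa : ~ chart_ball i x r (beta a) by rewrite ba.
  have Ub : chart_ball i x r (beta b) by rewrite bb.
  have [t [tab nU Kt]] := last_entrance oU cK UK (ab_le _ _ _ Pb)
    (piecewise_C1_continuous Pb) nUa Ub.
  move: (tab); rewrite in_itv /= => /andP[at_ tb].
  apply: le_trans (subpath_length_ge hF m0 Kd Km Pb at_ tb (lexx b) Kt).
  rewrite lee_fin ler_pM2l// bb distrC; apply: far => //.
  by apply: Kt; rewrite in_itv /= tb lexx.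
Qed.

Lemma finsler_dist_le_ball i x y z r C :
  0 <= C ->
  [set p | `|p - A i x| <= r] `<=` chart_img (A i) ->
  (forall p u, `|p - A i x| <= r -> finsler_coord F i (p, u) <= C * `|u|) ->
  chart_ball i x r y -> chart_ball i x r z ->
  (finsler_dist F y z <= (C * `|A i z - A i y|)%:E)%E.
Proof.
move=> C0 Bi BC [iy yr] [iz zr].
apply: (finsler_dist_le_line hF C0 iy iz Bi) => // t.
rewrite in_itv /= => /andP[t0 t1].
have -> : A i y + t *: (A i z - A i y) - A i x =
    (1 - t) *: (A i y - A i x) + t *: (A i z - A i x).
  by apply/rowP => k; rewrite !mxE; ring.
apply: le_trans (ler_normD _ _) _; rewrite !normrZ !ger0_norm ?subr_ge0//.
have -> : r = (1 - t) * r + t * r by rewrite -mulrDl subrK mul1r.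
by rewrite lerD// ler_wpM2l ?subr_ge0// ltW.
Qed.

Lemma finsler_local_comparison x : exists i r m C,
  [/\ chart_dom (A i) x, [/\ 0 < r, 0 < m & 0 < C],
      [set p | `|p - A i x| <= r] `<=` chart_img (A i) &
      forall p u, `|p - A i x| <= r ->
        m * `|u| <= finsler_coord F i (p, u) <= C * `|u|].
Proof.
have [i ix] := atlas_cover A x; exists i.
have /nbhs_ballP[e /= e0 eB] := chart_img_nbhs ix.
have Bi : [set p | `|p - A i x| <= e / 2] `<=` chart_img (A i).
  move=> p /= pe; apply: eB; rewrite -ball_normE /= distrC (le_lt_trans pe)//.
  by rewrite gtr_pMr// invf_lt1// ltr1n.
have [m [C [m0 C0 HmC]]] := norm_comparison
  (@norm_ball_compact _ _ (A i x) (e / 2))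
  (fun p u Bp => finsler_coord_continuous hF (Bi p Bp))
  (fun p u Bp u0 => finsler_coord_gt0 hF (Bi p Bp) u0)
  (fun p u l Bp l0 => finsler_coordZ hF i p u l0).
by exists (e / 2), m, C; split => //; split => //; rewrite divr_gt0.
Qed.

Lemma finsler_dist_cvg (x_ : nat -> M) (x : M) :
  ((finsler_dist F (x_ k) x @[k --> \oo] --> 0%E) <-> (x_ k @[k --> \oo] --> x)) /\
  ((finsler_dist F x (x_ k) @[k --> \oo] --> 0%E) <-> (x_ k @[k --> \oo] --> x)).
Proof.
have [i [r [m [C [ix [r0 m0 C0] Bi HmC]]]]] := finsler_local_comparison x.
(* The coordinate balls of radius at most r form a neighbourhood basis of x. *)
have shrink W : nbhs x W -> exists2 e, 0 < e <= r & chart_ball i x e `<=` W.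
  move=> Wx; have W' : nbhs (chart_inv (A i) (A i x)) W by rewrite chart_mapK.
  have ci : {for A i x, continuous (chart_inv (A i))}.
    by apply: chart_inv_continuous; exists x.
  have /nbhs_ballP[e /= e0 eW] := ci _ W'; exists (Num.min e r).
    by rewrite lt_min e0 r0 ge_min lexx orbT.
  move=> z [iz]; rewrite lt_min => /andP[ze _].
  rewrite -(chart_mapK iz); apply: eW.
  by rewrite -ball_normE /= distrC.
(* The sequence d_ stands for either of the two sequences of distances. *)
have to_top (d_ : nat -> \bar R) :
    (forall k, d_ k = finsler_dist F (x_ k) x \/ d_ k = finsler_dist F x (x_ k)) ->
    d_ k @[k --> \oo] --> 0%E -> x_ k @[k --> \oo] --> x.
  move=> dE dcvg W /shrink[e /andP[e0 er] eW].
  have d0 k : (0 <= d_ k)%E by case: (dE k) => ->; exact: finsler_dist_ge0.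
  have H := (cvge0P d0).1 dcvg _ (mulr_gt0 m0 e0).
  suff : \forall k \near \oo, W (x_ k) by [].
  apply: filterS H => k dk; apply/eW/(finsler_dist_lt_ball e0 m0 ix).
  - by move=> p /= pe; apply: Bi => /=; exact: le_trans er.
  - by move=> p u pe; have /andP[] := HmC p u (le_trans pe er).
  - by case: (dE k) => <-; [right|left].
have of_top (d_ : nat -> \bar R) :
    (forall k, d_ k = finsler_dist F (x_ k) x \/ d_ k = finsler_dist F x (x_ k)) ->
    x_ k @[k --> \oo] --> x -> d_ k @[k --> \oo] --> 0%E.
  move=> dE xcvg.
  have d0 k : (0 <= d_ k)%E by case: (dE k) => ->; exact: finsler_dist_ge0.
  apply/(cvge0P d0) => e e0.
  pose e' := Num.min r (e / C).
  have e'0 : 0 < e' by rewrite lt_min r0 divr_gt0.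
  have H : \forall k \near \oo, chart_ball i x e' (x_ k).
    apply: xcvg; apply: open_nbhs_nbhs; split; first exact: chart_ball_open.
    by split => //; rewrite subrr normr0.
  apply: filterS H => k [ik]; rewrite lt_min => /andP[kr ke].
  have Bx : chart_ball i x r x by split => //; rewrite subrr normr0.
  have Bk : chart_ball i x r (x_ k) by [].
  have HC p u : `|p - A i x| <= r -> finsler_coord F i (p, u) <= C * `|u|.
    by move=> /(HmC _ u)/andP[].
  have {}ke : C * `|A i (x_ k) - A i x| < e by rewrite mulrC -ltr_pdivlMr.
  case: (dE k) => ->.
    apply: le_lt_trans (finsler_dist_le_ball (ltW C0) Bi HC Bk Bx) _.
    by rewrite lte_fin distrC.
  by apply: le_lt_trans (finsler_dist_le_ball (ltW C0) Bi HC Bx Bk) _.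
by split; (split; [apply: to_top|apply: of_top]) => k; [left|left|right|right].
Qed.

End ball.

Theorem proposition4p4 (R : realType) (n : nat) (M : topologicalType)
    (A : smooth_manifold R n M) (F : tangent_bundle A -> R)
    (hF : finsler_structure F) :
  (forall (x_ : nat -> M) (x : M),
    ((finsler_dist F (x_ i) x @[i --> \oo] --> 0%E) <->
     (finsler_dist F x (x_ i) @[i --> \oo] --> 0%E)) /\
    ((finsler_dist F x (x_ i) @[i --> \oo] --> 0%E) <->
     (x_ i @[i --> \oo] --> x))) /\
  busemann_axiom (finsler_dist F).
Proof.
split=> x_ x; have [toP fromP] := finsler_dist_cvg hF x_ x.
  split => //; exact: iff_trans toP (iff_sym fromP).
exact: iff_trans toP (iff_sym fromP).
Qed.
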